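(* Let $M,N\ge3$ be integers. (1) For all $x\in\{-1,1\}^N$, $y\in\{-1,1\}^M$, every trivial toroidal Hitomezashi loop in $\mathrm{Cloth}_{M,N}(x,y)$ has length congruent to $4$ modulo $8$. (2) For all $x\in\{-1,1\}^N$, every nontrivial toroidal Hitomezashi loop in the symmetric pattern $\mathrm{Cloth}_{N,N}(x,x)$ has length congruent to $2|k(x)|$ modulo $8$. (3) For all $x\in\{-1,1\}^N$, $y\in\{-1,1\}^M$, if a nontrivial toroidal Hitomezashi loop in $\mathrm{Cloth}_{M,N}(x,y)$ has homology class $(\lambda,\mu)$, then its length is congruent to $2(\mu N+\lambda M-\mu k(x))$ modulo $8$.
   Context: Let $M,N\ge3$. $\mathrm{Cloth}_{M,N}$ is the graph with vertex set $\mathbb Z/M\mathbb Z\times\mathbb Z/N\mathbb Z$, with $(i,j)$ adjacent to $(i\pm1,j)$ and $(i,j\pm1)$. For $x\in\{-1,1\}^N$ (indexed by $\mathbb Z/N\mathbb Z$) and $y\in\{-1,1\}^M$ (indexed by $\mathbb Z/M\mathbb Z$), the toroidal Hitomezashi pattern $\mathrm{Cloth}_{M,N}(x,y)$ is the following orientation of $\mathrm{Cloth}_{M,N}$: the horizontal edge $\{(i,j),(i+1,j)\}$ is oriented $(i,j)\to(i+1,j)$ if $x_j=1$ and $(i+1,j)\to(i,j)$ if $x_j=-1$; the vertical edge $\{(i,j),(i,j+1)\}$ is oriented $(i,j)\to(i,j+1)$ if $y_i=1$ and $(i,j+1)\to(i,j)$ if $y_i=-1$. The pattern is symmetric if $M=N$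 and $x=y$. A toroidal Hitomezashi loop is a directed circuit (closed directed trail, no repeated edges, considered up to cyclic shift) in $\mathrm{Cloth}_{M,N}(x,y)$ whose edges alternate (cyclically) between vertical and horizontal edges; a loop may pass through a vertex twice. Its length is its number of edges. For a loop, $\Delta x$ is the number of its edges of the form $(i,j)\to(i+1,j)$ minus the number of its edges of the form $(i+1,j)\to(i,j)$, and $\Delta y$ is the number of its edges of the form $(i,j)\to(i,j+1)$ minus the number of the form $(i,j+1)\to(i,j)$. The homology class of the loop is $(\Delta x/M,\Delta y/N)$. A loop is trivial if its homology class is $(0,0)$ and nontrivial otherwise. For a string $x$ of $\pm1$'s, $k(x)$ is the number of $1$'s minus the number of $(-1)$'s in $x$. *)

(* Defs.v *)
From mathcomp Require Import all_boot all_order all_algebra.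

Set Implicit Arguments.
Unset Strict Implicit.
Unset Printing Implicit Defensive.

Import Order.TTheory GRing.Theory Num.Theory.
Local Open Scope ring_scope.

(* 'Z_n is Z/nZ only for n > 1; the results assume 3 <= M and 3 <= N. *)
Definition vertex (M N : nat) : Type := ('Z_M * 'Z_N)%type.

Definition sign_string (n : nat) (x : 'Z_n -> int) : Prop :=
  forall i, (x i = 1) \/ (x i = -1).

Definition excess (n : nat) (x : 'Z_n -> int) : int :=
  #|[set i | x i == 1]|%:Z - #|[set i | x i == -1]|%:Z.

Section Cloth.

Variables M N : nat.
Implicit Types (u v : vertex M N) (e f : vertex M N * vertex M N).

Definition cloth u v : bool :=
  [|| v == (u.1 + 1, u.2), v == (u.1 - 1, u.2),
      v == (u.1, u.2 + 1) | v == (u.1, u.2 - 1)].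

(* An arc e goes from e.1 to e.2.  Since M, N >= 3, at most one of the four
   predicates below holds of any given arc. *)
Definition rightward e : bool := e.2 == (e.1.1 + 1, e.1.2).
Definition leftward e : bool := e.1 == (e.2.1 + 1, e.2.2).
Definition upward e : bool := e.2 == (e.1.1, e.1.2 + 1).
Definition downward e : bool := e.1 == (e.2.1, e.2.2 + 1).

Definition horizontal e : bool := rightward e || leftward e.
Definition vertical e : bool := upward e || downward e.

Definition pattern (x : 'Z_N -> int) (y : 'Z_M -> int) e : bool :=
  [|| rightward e && (x e.1.2 == 1), leftward e && (x e.1.2 == -1),
      upward e && (y e.1.1 == 1) | downward e && (y e.1.1 == -1)].

Definition consecutive e f : bool := e.2 == f.1.

Definition alternate e f : bool :=
  (horizontal e && vertical f) || (vertical e && horizontal f).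

(* A loop is given by its cyclic sequence of arcs, starting anywhere; its
   length is then [size c].  The empty sequence is not a circuit. *)
Definition hitomezashi_loop (x : 'Z_N -> int) (y : 'Z_M -> int)
    (c : seq (vertex M N * vertex M N)) : Prop :=
  [/\ c != [::], all (pattern x y) c, uniq c,
      cycle consecutive c & cycle alternate c].

Definition delta_x (c : seq (vertex M N * vertex M N)) : int :=
  (count rightward c)%:Z - (count leftward c)%:Z.

Definition delta_y (c : seq (vertex M N * vertex M N)) : int :=
  (count upward c)%:Z - (count downward c)%:Z.

Definition homology (c : seq (vertex M N * vertex M N)) : rat * rat :=
  ((delta_x c)%:~R / M%:R, (delta_y c)%:~R / N%:R).

Definition trivial_loop (c : seq (vertex M N * vertex M N)) : Prop :=
  homology c = (0, 0).

End Cloth.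

Lemma Zp_step2 (n : nat) (i j : 'Z_n) :
  (2 < n)%N -> i = j + 1 -> j = i + 1 -> False.
Proof.
move=> n_gt2 ->; rewrite -addrA -{1}[j]addr0 => /addrI two0.
have: nat_of_ord (2%:R : 'Z_n) = 0%N by rewrite mulr2n -two0.
by rewrite val_Zp_nat ?modn_small // ltnW.
Qed.

Lemma Zp_step1 (n : nat) (i : 'Z_n) : (i == i + 1) = false.
Proof. by rewrite -{1}[i]addr0 (inj_eq (addrI i)) eq_sym oner_eq0. Qed.

(* For M, N >= 3 the pattern is an orientation of the simple graph [cloth]:
   every edge is directed in exactly one way. *)
Lemma pattern_orients (M N : nat) (x : 'Z_N -> int) (y : 'Z_M -> int) :
    (2 < M)%N -> (2 < N)%N -> sign_string x -> sign_string y ->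
  forall u v, cloth u v = pattern x y (u, v) (+) pattern x y (v, u).
Proof.
move=> M3 N3 hx hy [i j] [i' j'].
rewrite /cloth /pattern /rightward /leftward /upward /downward /= !xpair_eqE /=.
rewrite !(eq_sym i' (i - 1)) !(eq_sym j' (j - 1)) !subr_eq.
case: (eqVneq j' j) => [->|nj]; case: (eqVneq i' i) => [->|ni];
  rewrite ?eqxx ?Zp_step1 ?andbF ?andbT ?orbF //=.
- case: (eqVneq i' (i + 1)) => [e1|_]; case: (eqVneq i (i' + 1)) => [e2|_] //=.
  + by case: (Zp_step2 M3 e1 e2).
  + by rewrite ?orbF; case: (hx j) => ->.
  + by rewrite ?orbF; case: (hx j) => ->.
- case: (eqVneq j' (j + 1)) => [e1|_]; case: (eqVneq j (j' + 1)) => [e2|_] //=.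
  + by case: (Zp_step2 N3 e1 e2).
  + by rewrite ?orbF; case: (hy i) => ->.
  + by rewrite ?orbF; case: (hy i) => ->.
Qed.

Lemma cycle_sum0 (T : eqType) (V : zmodType) (s t : T -> V) (c : seq T) :
  cycle (fun e f => t e == s f) c -> \sum_(e <- c) (t e - s e) = 0.
Proof.
case: c => [|e0 c] /=; first by rewrite big_nil.
suff gen a d w : path (fun e f => t e == s f) a (rcons d w) ->
    \sum_(e <- d) (t e - s e) = s w - t a.
  by move/gen; rewrite big_cons => ->; rewrite addrC addrA subrK subrr.
elim: d a => [|b d IHd] a /=.
  by rewrite andbT big_nil => /eqP ->; rewrite subrr.
by case/andP=> /eqP -> /IHd; rewrite big_cons => ->; rewrite addrC addrA subrK.
Qed.

Lemma Zp_int_eq0 (n : nat) (d : int) :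
  (1 < n)%N -> (d%:~R : 'Z_n) = 0 -> exists l : int, d = l * n%:Z.
Proof.
move=> n1 d0; apply/dvdzP; rewrite dvdzE /=.
have: ((`|d|%N)%:R : 'Z_n) = 0.
  by case: d d0 => m //=; rewrite NegzE mulrNz => /eqP; rewrite oppr_eq0 => /eqP.
by move/(congr1 (@nat_of_ord _)); rewrite val_Zp_nat //= /dvdn => ->.
Qed.

Lemma step_x (M N : nat) (e : vertex M N * vertex M N) :
    (2 < M)%N -> [|| horizontal e | vertical e] ->
  ((rightward e)%:Z - (leftward e)%:Z)%:~R = e.2.1 - e.1.1.
Proof.
move=> M3; case: e => -[i j] [i' j'].
rewrite /horizontal /vertical /rightward /leftward /upward /downward /=.
rewrite !xpair_eqE /= (eq_sym j' j).
have [e1|n1] := eqVneq i' (i + 1); have [e2|n2] := eqVneq i (i' + 1) => /=.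
- by case: (Zp_step2 M3 e1 e2).
- rewrite {}e1 [i + 1 == i]eq_sym Zp_step1 !orbF /= => ->.
  by rewrite subr0 [i + 1]addrC addrK.
- rewrite {}e2 [_ + 1 == _]eq_sym Zp_step1 !orbF /= => ->.
  by rewrite sub0r opprD addNKr.
by rewrite [i' == i]eq_sym -andb_orr => /andP[/eqP -> _]; rewrite !subrr.
Qed.

Lemma step_y (M N : nat) (e : vertex M N * vertex M N) :
    (2 < N)%N -> [|| horizontal e | vertical e] ->
  ((upward e)%:Z - (downward e)%:Z)%:~R = e.2.2 - e.1.2.
Proof.
move=> N3; case: e => -[i j] [i' j'].
rewrite /horizontal /vertical /rightward /leftward /upward /downward /=.
rewrite !xpair_eqE /= (eq_sym i' i).
have [e1|n1] := eqVneq j' (j + 1); have [e2|n2] := eqVneq j (j' + 1) => /=.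
- by case: (Zp_step2 N3 e1 e2).
- rewrite {}e1 [j + 1 == j]eq_sym Zp_step1 !andbF ?andbT ?orbF /= => ->.
  by rewrite subr0 [j + 1]addrC addrK.
- rewrite {}e2 [_ + 1 == _]eq_sym Zp_step1 !andbF ?andbT ?orbF /= => ->.
  by rewrite sub0r opprD addNKr.
by rewrite !andbF !orbF [j' == j]eq_sym -andb_orl => /andP[_ /eqP ->]; rewrite !subrr.
Qed.

Lemma loop_delta (M N n : nat) (x : 'Z_N -> int) (y : 'Z_M -> int)
    (c : seq (vertex M N * vertex M N)) (P Q : pred (vertex M N * vertex M N))
    (p : vertex M N -> 'Z_n) :
    (1 < n)%N -> hitomezashi_loop x y c ->
    (forall e, [|| horizontal e | vertical e] ->
       ((P e)%:Z - (Q e)%:Z)%:~R = p e.2 - p e.1) ->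
  exists l : int, (count P c)%:Z - (count Q c)%:Z = l * n%:Z.
Proof.
move=> n1 [_ /allP hp _ hc _] step; apply: Zp_int_eq0 => //.
have -> : (count P c)%:Z - (count Q c)%:Z =
    \sum_(e <- c) ((P e)%:Z - (Q e)%:Z).
  elim: (c) => [|e d IHd]; first by rewrite big_nil.
  by rewrite big_cons -IHd /= !PoszD opprD addrACA.
rewrite rmorph_sum -[RHS](@cycle_sum0 _ _ (fun e => p e.1) (fun e => p e.2) c).
  apply: eq_big_seq => e /hp pe; apply: step.
  by rewrite /horizontal /vertical; case/or4P: pe => /andP[-> _]; rewrite ?orbT.
by apply: sub_cycle hc => e f /eqP ->.
Qed.

(* The homology class of a loop is integral, as needed for it to occur in a
   congruence between integers. *)
Lemma homology_int (M N : nat) (x : 'Z_N -> int) (y : 'Z_M -> int)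
    (c : seq (vertex M N * vertex M N)) :
    (2 < M)%N -> (2 < N)%N -> hitomezashi_loop x y c ->
  exists l m : int, homology c = (l%:~R, m%:~R).
Proof.
move=> M3 N3 hc.
have [l dl] : exists l : int, delta_x c = l * M%:Z.
  by apply: (loop_delta (p := fst) (ltnW M3) hc) => e; apply: step_x.
have [m dm] : exists m : int, delta_y c = m * N%:Z.
  by apply: (loop_delta (p := snd) (ltnW N3) hc) => e; apply: step_y.
exists l, m; rewrite /homology dl dm !intrM !mulfK // pnatr_eq0 -lt0n.
  exact: leq_trans N3.
exact: leq_trans M3.
Qed.

(* Main.v *)
Require Import Defs.
From mathcomp Require Import all_boot all_order all_algebra.
From mathcomp Require Import zify ring.

(* Lift the loop to the plane, starting with a horizontal edge: the vertices
   P_t = (a_t, b_t) reached after 2t edges obey a' = a + x(b), b' = b + y(a'),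
   and a loop of length 2n of class (lambda, mu) has
   P_(t+n) = P_t + (lambda M, mu N).  For one period, the turns determine
   2n mod 8 in terms of lambda, mu, k(x) and the parity of the number of left
   edges between two vertical edges of opposite signs.  This parity is that of
   the rotation number of the path P, which moves by diagonal unit steps and
   visits no lattice point twice.  As in Hopf's Umlaufsatz, the closed paths of
   secants s |-> P_(s+d) - P_s have a winding number independent of d: for a
   nontrivial loop d = n gives constant secants, and for a trivial loop d = n/2
   gives a path which is antipodal after half a period, of odd winding number.

   In the symmetric pattern 2 S(b) + x(b) - 2 S(a) - x(a) - x(a) x(b) is
   constant along P, where S(z+1) - S(z) = x(z).  Hence mu k = lambda k.  If
   k > 0, let A and B be the last points where S takes two values whose
   difference is given by the constant: the quadrant {a >= A, b >= B} cannot be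
   left, and can be entered only at (A, B).  So P goes through (A, B) and
   (A + N, B + N), which forces lambda = mu = 1, and the case k < 0
   follows by the symmetry z |-> -z.  If k = 0, a nontrivial loop would cross
   columns (or rows) where S is minimal and others where S is maximal, which
   gives contradictory bounds on the constant. *)

Import Order.TTheory GRing.Theory Num.Theory.
Local Open Scope ring_scope.

Set Implicit Arguments.
Unset Strict Implicit.
Unset Printing Implicit Defensive.

(** * Winding numbers modulo 2 of lattice paths *)

Definition unit_int (z : int) : Prop := z = 1 \/ z = -1.

(* Crossing the ray from the origin towards (-oo, 0), lowered to ordinate -1/2
   so that it avoids the lattice points. *)
Definition crosses (p q : int * int) : bool :=
  ((0 <= p.2) (+) (0 <= q.2)) && (p.1 + q.1 < 0).

Lemma crossesC p q : crosses p q = crosses q p.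
Proof. by rewrite /crosses addbC addrC. Qed.

(* A unit square whose corners are of even parity and differ from 0 does not
   surround 0. *)
Lemma crosses_square (u v w d1 d2 e1 e2 : int) :
    unit_int d1 -> unit_int d2 -> unit_int e1 -> unit_int e2 -> u = v + 2 * w ->
    (u, v) != 0 -> (u + d1, v + d2) != 0 -> (u - e1, v - e2) != 0 ->
    (u + d1 - e1, v + d2 - e2) != 0 ->
  crosses (u, v) (u + d1, v + d2) (+)
    crosses (u + d1, v + d2) (u + d1 - e1, v + d2 - e2) =
  crosses (u, v) (u - e1, v - e2) (+)
    crosses (u - e1, v - e2) (u + d1 - e1, v + d2 - e2).
Proof.
rewrite /crosses !xpair_eqE /=.
by move=> [->|->] [->|->] [->|->] [->|->] ->; lia.
Qed.

(** If [g != g'], the intermediate secant lies on the horizontal axis; it is nonzero, so [f = f'],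
    and the ray is met exactly when both steps go left. If [g = g'], no ordinate changes sign. *)
Lemma crosses_turn (f g f' g' : int) :
    unit_int f -> unit_int g -> unit_int f' -> unit_int g' ->
    (f + f', g + g') != 0 ->
  crosses (f, g) (f + f', g + g') (+) crosses (f + f', g + g') (f', g') =
  (f' == -1) && (g != g').
Proof. by move=> [->|->] [->|->] [->|->] [->|->]. Qed.

(* Its boundary is crossed where the ray of [crosses] or the opposite ray is. *)
Definition half_plane (p : int * int) : bool :=
  (0 < p.2) || ((p.2 == 0) && (p.1 < 0)).

Lemma crosses_opp (p q : int * int) :
    unit_int (q.1 - p.1) -> unit_int (q.2 - p.2) -> p != 0 -> q != 0 ->
  crosses p q (+) crosses (- p) (- q) = half_plane p (+) half_plane q.
Proof.
case: p q => [u v] [u' v'] /=; rewrite /crosses /half_plane !xpair_eqE /=.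
by move=> [?|?] [?|?]; lia.
Qed.

Definition unit_steps (u : nat -> int) : Prop := forall t, unit_int (u t.+1 - u t).

Definition secant (u w : nat -> int) (s t : nat) : int * int :=
  (u t - u s, w t - w s).

(* Consecutive secants over [d] steps differ by two diagonal unit steps; they are
   joined through a secant over [d.+1] steps. *)
Definition secant_winding (u w : nat -> int) (n d : nat) : bool :=
  \big[addb/false]_(0 <= s < n)
    (crosses (secant u w s (s + d)) (secant u w s (s + d).+1) (+)
     crosses (secant u w s (s + d).+1) (secant u w s.+1 (s + d).+1)).

(** Every step changes [u] and [w] by odd amounts, so [u - w] keeps its parity. With [Posz] as one
    of the sequences this compares a displacement with a number of steps. *)
Lemma unit_steps_parity (u w : nat -> int) (s t : nat) :
  unit_steps u -> unit_steps w ->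
  exists k, u t - u s = (w t - w s) + 2 * k.
Proof.
move=> hu hw.
have par r : exists k, u r - w r = u 0%N - w 0%N + 2 * k.
  elim: r => [|r [k IHr]]; first by exists 0; lia.
  by case: (hu r) (hw r) => ? [] ?; [exists k | exists (k + 1) | exists (k - 1) | exists k]; lia.
by have [[k ?] [l ?]] := (par s, par t); exists (l - k); lia.
Qed.

(** Moving the end of the secant before its start, or after it, gives two routes around a square
    that does not surround 0. *)
Lemma secant_square (u w : nat -> int) (s t : nat) :
    unit_steps u -> unit_steps w ->
    secant u w s t != 0 -> secant u w s t.+1 != 0 ->
    secant u w s.+1 t != 0 -> secant u w s.+1 t.+1 != 0 ->
  crosses (secant u w s t) (secant u w s t.+1) (+)
    crosses (secant u w s t.+1) (secant u w s.+1 t.+1) =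
  crosses (secant u w s t) (secant u w s.+1 t) (+)
    crosses (secant u w s.+1 t) (secant u w s.+1 t.+1).
Proof.
move=> hu hw; have [k] := unit_steps_parity s t hu hw; rewrite /secant.
have -> : u t.+1 - u s = u t - u s + (u t.+1 - u t) by ring.
have -> : w t.+1 - w s = w t - w s + (w t.+1 - w t) by ring.
have -> : u t - u s.+1 = u t - u s - (u s.+1 - u s) by ring.
have -> : w t - w s.+1 = w t - w s - (w s.+1 - w s) by ring.
have -> : u t.+1 - u s.+1 = u t - u s + (u t.+1 - u t) - (u s.+1 - u s) by ring.
have -> : w t.+1 - w s.+1 = w t - w s + (w t.+1 - w t) - (w s.+1 - w s) by ring.
by move=> uw *; apply: (@crosses_square _ _ k).
Qed.

Lemma big_addb_shift (F : nat -> bool) (n : nat) : F n = F 0%N ->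
  \big[addb/false]_(0 <= s < n) F s.+1 = \big[addb/false]_(0 <= s < n) F s.
Proof.
case: n => [|n] Fn; first by rewrite !big_geq.
by rewrite big_nat_recr //= [RHS]big_nat_recl //= addbC Fn.
Qed.

Definition secant_periodic (u w : nat -> int) (n : nat) (p q : int) : Prop :=
  forall t, u (t + n)%N = u t + p /\ w (t + n)%N = w t + q.

Lemma secant_shift u w n p q s t : secant_periodic u w n p q ->
  secant u w (s + n) (t + n) = secant u w s t.
Proof.
by move=> per; rewrite /secant; have [[-> ->] [-> ->]] := (per s, per t);
  congr (_, _); ring.
Qed.

(** Once [secant_square] has reordered the moves over [d.+1] steps, both sides contain the same two
    families of crossings, one of them shifted by one index; periodicity absorbs the shift. *)
Lemma secant_windingS u w n p q d :
    unit_steps u -> unit_steps w -> secant_periodic u w n p q ->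
    (forall s e, (d <= e <= d.+2)%N -> secant u w s (s + e) != 0) ->
  secant_winding u w n d.+1 = secant_winding u w n d.
Proof.
move=> hu hw per nz; rewrite /secant_winding.
under eq_big_nat => s _.
  rewrite secant_square //; first last.
  - by have := nz s.+1 d.+1; rewrite addSnnS -addnS; apply; lia.
  - by have := nz s.+1 d; rewrite addSnnS; apply; lia.
  - by rewrite -addnS nz //; lia.
  - by rewrite nz //; lia.
  over.
rewrite big_split [RHS]big_split /= addbC; congr addb; last first.
  by apply: eq_bigr => s _; rewrite addnS.
rewrite -[RHS]big_addb_shift; first by apply: eq_bigr => s _; rewrite addnS.
by rewrite add0n addnC -addSn -{1 3}[n]add0n !(secant_shift _ _ per).
Qed.

Lemma secant_winding_const u w n p q d :
    unit_steps u -> unit_steps w -> secant_periodic u w n p q -> (0 < d)%N ->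
    (forall s e, (0 < e <= d.+1)%N -> secant u w s (s + e) != 0) ->
  secant_winding u w n d = secant_winding u w n 1.
Proof.
move=> hu hw per; elim: d => // -[//|d] IHd _ nz.
rewrite (secant_windingS hu hw per) => [|s e he]; last by apply: nz; lia.
by apply: IHd => // s e he; apply: nz; lia.
Qed.

(* The secants over a full period all equal (p, q). *)
Lemma secant_winding_nonclosed u w n p q :
    unit_steps u -> unit_steps w -> secant_periodic u w n p q -> (0 < n)%N ->
    (forall s t, (s < t)%N -> secant u w s t != 0) ->
  secant_winding u w n 1 = false.
Proof.
move=> hu hw per n0 nz.
rewrite -(secant_winding_const hu hw per n0); last by move=> *; apply: nz; lia.
rewrite /secant_winding big1 // => s _; rewrite crossesC addbC.
(* Each summand thus goes from (p, q) to an intermediate secant and straight back. *)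
have -> : secant u w s.+1 (s + n).+1 = secant u w s (s + n).
  by rewrite -addSn /secant; have [[-> ->] [-> ->]] := (per s, per s.+1);
    congr (_, _); ring.
by rewrite crossesC addbb.
Qed.

(* Secants over half a period are antipodal after half a period, so that the
   closed path they describe winds an odd number of times. *)
Lemma secant_winding_closed u w m :
    unit_steps u -> unit_steps w -> secant_periodic u w (m + m) 0 0 -> (1 < m)%N ->
    (forall s t, (s < t < s + (m + m))%N -> secant u w s t != 0) ->
  secant_winding u w (m + m) 1 = true.
Proof.
move=> hu hw per m1 nz.
have opp s t : secant u w t (s + (m + m)) = - secant u w s t.
  rewrite /secant; have [-> ->] := per s.
  by rewrite -[RHS]/(- (u t - u s), - (w t - w s)); congr (_, _); ring.
rewrite -(@secant_winding_const u w (m + m) 0 0 m) //; first last.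
  by move=> *; apply: nz; lia.
  by lia.
rewrite /secant_winding (@big_cat_nat _ _ _ m) ?leq_addr //=.
rewrite [X in _ (+) X](big_addn 0 _ m) addnK -big_split /=.
(* Crossings at [s] and at [s + m] together record changes of half-plane. Their sum telescopes to
   [h 0 (+) h m], which is true because the two secants are antipodal. *)
pose h s := half_plane (secant u w s (s + m)).
rewrite (eq_bigr (fun s => h s (+) h s.+1)).
  rewrite big_split /=.
  have -> (F : nat -> bool) : \big[addb/false]_(0 <= s < m) F s (+)
      \big[addb/false]_(0 <= s < m) F s.+1 = F 0%N (+) F m.
    elim: (m) => [|k IHk]; first by rewrite !big_geq // !addbb.
    by rewrite !big_nat_recr //= addbACA IHk -addbA addKb.
  have := nz 0%N m; rewrite /h -[(m + m)%N]add0n opp add0n /half_plane.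
  case: (secant u w 0 m) => a b; rewrite xpair_eqE /= => H.
  have : ~~ ((a == 0) && (b == 0)) by apply: H; lia.
  by lia.
(* Reordering the moves makes the intermediate secants of the two halves antipodal as well. *)
move=> s _; rewrite secant_square; [|by [|] | by [|] | by apply: nz; lia..].
have -> : (s + m + m = s + (m + m))%N by lia.
rewrite -!addSn !opp addbACA !crosses_opp; try by apply: nz; lia.
- by rewrite /h -addbA addKb.
- by have := hu (s + m)%N; rewrite /secant /=; congr unit_int; ring.
- by have := hw (s + m)%N; rewrite /secant /=; congr unit_int; ring.
- by rewrite /secant /=; have [?|?] := hu s; [right|left]; lia.
- by rewrite /secant /=; have [?|?] := hw s; [right|left]; lia.
Qed.

(** * Lengths of loops modulo 8 *)

Lemma secant_winding1 (u w : nat -> int) (n : nat) :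
    unit_steps u -> unit_steps w -> (forall s, secant u w s s.+2 != 0) ->
  secant_winding u w n 1 =
  \big[addb/false]_(0 <= s < n)
    ((u s.+2 - u s.+1 == -1) && (w s.+1 - w s != w s.+2 - w s.+1)).
Proof.
move=> hu hw nz; apply: eq_bigr => s _; rewrite addn1.
have:= nz s; rewrite /secant.
rewrite (_ : u s.+2 - u s = (u s.+1 - u s) + (u s.+2 - u s.+1)); last by ring.
rewrite (_ : w s.+2 - w s = (w s.+1 - w s) + (w s.+2 - w s.+1)); last by ring.
exact: crosses_turn.
Qed.

Definition stitch_orbit (f g : int -> int) (a b : nat -> int) : Prop :=
  forall t, a t.+1 = a t + f (b t) /\ b t.+1 = b t + g (a t.+1).

Lemma orbit_unit_steps f g a b :
    (forall z, unit_int (f z)) -> (forall z, unit_int (g z)) -> stitch_orbit f g a b ->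
  unit_steps a /\ unit_steps b.
Proof.
move=> hf hg ab; split=> t; have [ea eb] := ab t.
- by rewrite ea addrC addKr.
- by rewrite eb addrC addKr.
Qed.

Definition antiderivative (f S : int -> int) : Prop := forall z, S (z + 1) = S z + f z.

Lemma shift_mul (S : int -> int) (p k : int) :
  (forall z, S (z + p) = S z + k) -> forall m z, S (z + m * p) = S z + m * k.
Proof.
move=> Sp m z; elim/int_ind: m => [|m IHm|m IHm]; first by rewrite !mul0r !addr0.
- have -> : z + m.+1%:Z * p = z + m%:Z * p + p by rewrite intS; ring.
  by rewrite Sp IHm intS; ring.
- apply: (@addIr _ k); rewrite -Sp.
  have -> : z + - m.+1%:Z * p + p = z + - m%:Z * p by rewrite intS; ring.
  by rewrite IHm intS; ring.
Qed.

(** Since [2 * S z + f z] is [S z + S (z + 1)], it varies by the same formula for steps in both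
    directions. *)
Lemma antiderivative_step (f S : int -> int) (z d : int) :
  antiderivative f S -> unit_int d ->
  2 * S (z + d) + f (z + d) = 2 * S z + f z + d * (f z + f (z + d)).
Proof.
move=> hS [->|->]; first by rewrite hS; ring.
by have := hS (z - 1); rewrite subrK => ->; ring.
Qed.

(* Sums [2 = 2 f + (g + g') - f (g + g') + 4 [f = -1 and g <> g'] mod 8], valid for
   signs f, g, g'; the sum of [f (g + g')] telescopes to the variation of H. *)
Lemma orbit_length_turns f g S a b n :
    (forall z, unit_int (f z)) -> (forall z, unit_int (g z)) ->
    antiderivative f S -> stitch_orbit f g a b ->
  let H t := 2 * S (b t) + f (b t) + f (b t) * (b t.+1 - b t) in
  exists z : int,
    2 * n%:Z = 2 * (a n.+1 - a 1%N) + (b n + b n.+1 - b 0%N - b 1%N)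
      - (H n - H 0%N)
      + 4 * (\big[addb/false]_(0 <= s < n)
          ((a s.+2 - a s.+1 == -1) && (b s.+1 - b s != b s.+2 - b s.+1)) : nat)%:Z
      + 8 * z.
Proof.
move=> hf hg hS ab H; have [ua ub] := orbit_unit_steps hf hg ab.
elim: n => [|n [z IHn]]; first by exists 0; rewrite big_geq //=; ring.
have eH : H n.+1 = H n + f (b n.+1) * (b n.+2 - b n).
  have := antiderivative_step (b n) hS (ub n); rewrite /H subrKC => ->; ring.
rewrite big_nat_recr //= {}eH.
move: (\big[_/_]_(_ <= _ < _) _) IHn => B IHn.
have ef : a n.+2 - a n.+1 = f (b n.+1) by have [-> _] := ab n.+1; rewrite addrC addKr.
(* Here [B] is the parity so far; the variation of the 0-1 value of [B] under addition of a bit is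
   that bit modulo 2, so four times it is right modulo 8. *)
have [e he] : exists e, 2 = 2 * f (b n.+1) + (b n.+2 - b n) -
    f (b n.+1) * (b n.+2 - b n) + 4 * ((B (+) ((f (b n.+1) == -1) &&
    (b n.+1 - b n != b n.+2 - b n.+1)) : nat)%:Z - (B : nat)%:Z) + 8 * e.
  rewrite -[b n.+2 - b n](subrKA (b n.+1)) addrC.
  by case: (hf (b n.+1)) (ub n) (ub n.+1) => -> [] -> [] ->; case: (B);
    (exists 0 + exists 1).
exists (z + e); rewrite ef intS mulrDr mulr1 IHn [X in X + _ = _]he -ef; ring.
Qed.

(** A horizontal arc is determined by its tail, as its row fixes its direction. Hence the absence of
    repeated arcs becomes the last clause: tails of horizontal arcs are distinct on the torus within
    a period. *)
Definition lifted_loop (M N : nat) (f g : int -> int) (a b : nat -> int) (n : nat)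
    (lambda mu : int) : Prop :=
  [/\ (0 < n)%N, stitch_orbit f g a b,
      secant_periodic a b n (lambda * M%:Z) (mu * N%:Z)
    & forall s t, (M %| a t - a s)%Z -> (N %| b t - b s)%Z -> s = t %[mod n]].

Lemma secant_periodic_mul a b n p q : secant_periodic a b n p q ->
  forall j t, a (t + j * n)%N = a t + j%:Z * p /\ b (t + j * n)%N = b t + j%:Z * q.
Proof.
move=> per j t; elim: j => [|j [IHa IHb]]; first by rewrite !mul0r addn0 !addr0.
rewrite (_ : (t + j.+1 * n = t + j * n + n)%N); last by lia.
by have [-> ->] := per (t + j * n)%N; rewrite IHa IHb intS; split; ring.
Qed.

(** The orbit is determined by its current point and [f], [g] are periodic, so reaching a translate
    of the initial point once forces periodicity for ever. *)
Lemma lifted_loopP (M N : nat) f g a b n lambda mu :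
    (forall z, f (z + N%:Z) = f z) -> (forall z, g (z + M%:Z) = g z) ->
    (0 < n)%N -> stitch_orbit f g a b ->
    a n = a 0%N + lambda * M%:Z -> b n = b 0%N + mu * N%:Z ->
    (forall s t, (s < t < n)%N -> (M %| a t - a s)%Z -> (N %| b t - b s)%Z -> False) ->
  lifted_loop M N f g a b n lambda mu.
Proof.
move=> fN gM n0 ab an bn dis.
have fN' m z : f (z + m * N%:Z) = f z.
  by rewrite (@shift_mul f N%:Z 0) ?mulr0 ?addr0 // => ?; rewrite fN addr0.
have gM' m z : g (z + m * M%:Z) = g z.
  by rewrite (@shift_mul g M%:Z 0) ?mulr0 ?addr0 // => ?; rewrite gM addr0.
have per : secant_periodic a b n (lambda * M%:Z) (mu * N%:Z).
  elim=> [|t [IHa IHb]]; first by rewrite add0n.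
  rewrite addSn; have [-> ->] := ab t; have [-> ->] := ab (t + n)%N.
  by rewrite IHb fN' IHa -[_ + _ + f _]addrAC gM'; split; ring.
split=> // s t.
have red r : exists j : nat, (a r = a (r %% n)%N + j%:Z * (lambda * M%:Z)) /\
    (b r = b (r %% n)%N + j%:Z * (mu * N%:Z)).
  by exists (r %/ n)%N; have := secant_periodic_mul per (r %/ n) (r %% n); rewrite addnC -divn_eq.
have [[j [-> ->]] [i [-> ->]]] := (red s, red t).
have dvd p (x y : int) (i' j' l : int) :
    (p %| x + i' * (l * p) - (y + j' * (l * p)))%Z = (p %| x - y)%Z.
  by rewrite opprD addrACA -mulrBl mulrA rpredDr // dvdz_mull.
rewrite !dvd => da db; apply/eqP; apply: contraT; rewrite neq_ltn.
have [sn tn] : (s %% n < n)%N /\ (t %% n < n)%N by rewrite !ltn_mod.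
case/orP=> lt; first by case: (dis (s %% n)%N (t %% n)%N); rewrite ?lt.
by case: (dis (t %% n)%N (s %% n)%N); rewrite ?lt // -rpredN opprB.
Qed.

Lemma lifted_loop_secant (M N : nat) f g a b n lambda mu s t :
    (0 < M)%N -> (0 < N)%N -> lifted_loop M N f g a b n lambda mu ->
    (s < t)%N -> secant a b s t = 0 ->
  [/\ lambda = 0, mu = 0 & (s + n <= t)%N].
Proof.
move=> M0 N0 [n0 _ per dis] lt [ea eb].
have mod : t = s %[mod n] by apply: esym; apply: dis; rewrite ?ea ?eb dvdz0.
have /dvdnP [j ej] : (n %| t - s)%N by rewrite -eqn_mod_dvd 1?ltnW // mod.
have et : t = (s + j * n)%N by lia.
have j0 : (0 < j)%N by case: j ej et => // ej et; lia.
have := secant_periodic_mul per j s; rewrite -et => -[ta tb].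
split; last by rewrite et leq_add2l leq_pmull.
- by move/eqP: ea; rewrite ta addrC addKr !mulf_eq0 => /or3P[||] /eqP //; lia.
- by move/eqP: eb; rewrite tb addrC addKr !mulf_eq0 => /or3P[||] /eqP //; lia.
Qed.

Lemma lifted_loop_length (M N : nat) f g (S : int -> int) a b n (lambda mu k : int) :
    (0 < M)%N -> (0 < N)%N ->
    (forall z, unit_int (f z)) -> (forall z, unit_int (g z)) ->
    antiderivative f S -> (forall z, S (z + N%:Z) = S z + k) ->
    lifted_loop M N f g a b n lambda mu ->
  exists z, 2 * n%:Z = (if (lambda == 0) && (mu == 0) then 4 else
    2 * (mu * N%:Z + lambda * M%:Z - mu * k)) + 8 * z.
Proof.
move=> M0 N0 hf hg hS SN ll; have [n0 ab per _] := ll.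
have [ua ub] := orbit_unit_steps hf hg ab.
(* A trivial loop of length 4 is treated apart: its secants over two steps vanish. *)
have [n2|nn2] := boolP [&& lambda == 0, mu == 0 & n == 2%N].
  by case/and3P: n2 => -> -> /eqP ->; exists 0.
have nz s : secant a b s s.+2 != 0.
  apply/eqP => /(lifted_loop_secant M0 N0 ll (ltnW (ltnSn _)))[l0 m0 le].
  have n1 : n = 1%N by move: nn2; rewrite l0 m0 /=; lia.
  have := per 0%N; rewrite n1 l0 add0n mul0r addr0 => -[a1 _].
  by have := ua 0%N; rewrite a1 subrr; case.
have [z] := orbit_length_turns n hf hg hS ab.
rewrite -(secant_winding1 n ua ub nz).
have := per 0%N; rewrite add0n => -[_ ->].
have:= per 1%N; rewrite add1n => -[-> ->].
have fN : f (b 0%N + mu * N%:Z) = f (b 0%N).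
  apply: (@addrI _ (S (b 0%N + mu * N%:Z))); rewrite -hS.
  rewrite addrAC !(shift_mul SN) hS; ring.
rewrite (shift_mul SN) {}fN => ez.
have [/andP[/eqP l0 /eqP m0]|nt] := ifP; last first.
  exists z; rewrite ez (secant_winding_nonclosed ua ub per n0) => [|s t lt].
    by rewrite /= mulr0 addr0; ring.
  by apply/eqP => /(lifted_loop_secant M0 N0 ll lt)[l0 m0 _]; rewrite l0 m0 eqxx in nt.
move: per nn2 ez; rewrite l0 m0 !mul0r eqxx /= => per nn2.
(* The closed sequence [a] returns after [n] unit steps, so [n] is even and half a period makes
   sense. *)
have un : unit_steps Posz by move=> t; left; lia.
have [k' ek] := unit_steps_parity 0 n ua un.
have [m en] : exists m, n = (m + m)%N.
  by exists `|k'|%N; move: ek; have := per 0%N; rewrite add0n addr0 => -[-> _]; lia.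
rewrite en in per nn2 n0 ll *; rewrite secant_winding_closed //; last 2 first.
- by lia.
- move=> s t lt; apply/eqP => sec0.
  have lt' : (s < t)%N by lia.
  by have [_ _] := lifted_loop_secant M0 N0 ll lt' sec0; lia.
by move=> ez; exists z; rewrite ez /=; ring.
Qed.

(** * Symmetric patterns *)

Definition level (f S : int -> int) (a b : int) : int :=
  2 * (S b - S a) + f b - f a - f a * f b.

(** Passing to the next vertex along a horizontal edge only flips the sign of the product term; by
    [level_vertical], the vertical edge that follows flips it back. *)
Lemma level_horizontal f S a b : antiderivative f S -> unit_int (f b) ->
  level f S a b =
    2 * (S b - S (a + f b)) + f b - f (a + f b) + f b * f (a + f b).
Proof.
move=> hS fb; have := antiderivative_step a hS fb; rewrite /level => e.
by rewrite mulrBr mulrBr -[2 * S (a + f b)](addrK (f (a + f b))) e; ring.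
Qed.

Lemma level_vertical f S a b : antiderivative f S -> unit_int (f a) ->
  level f S a (b + f a) = 2 * (S b - S a) + f b - f a + f b * f a.
Proof.
move=> hS fa; have := antiderivative_step b hS fa; rewrite /level => e.
by rewrite mulrBr mulrBr -[2 * S (b + f a)](addrK (f (b + f a))) e; ring.
Qed.

Lemma level_orbit f S a b t : (forall z, unit_int (f z)) -> antiderivative f S ->
  stitch_orbit f f a b -> level f S (a t) (b t) = level f S (a 0%N) (b 0%N).
Proof.
move=> hf hS ab; elim: t => [//|t <-]; have [-> ->] := ab t.
by rewrite level_vertical // (level_horizontal _ hS).
Qed.

(** The part without [S] is 3 if [f a = -1] and [f b = 1], and -1 otherwise. *)
Lemma level_odd (f S : int -> int) a b : (forall z, unit_int (f z)) ->
  exists c, level f S a b = 2 * c - 1.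
Proof.
rewrite /level => hf; exists (S b - S a + ((f a == -1) && (f b == 1) : nat)%:Z * 2).
by case: (hf a) (hf b) => -> [] -> /=; ring.
Qed.

(** * Last passages and trapping quadrants *)

Definition last_passage (S : int -> int) (v z : int) : Prop :=
  S z = v /\ forall z', z < z' -> v < S z'.

Lemma last_passage_step f S v z : (forall z, unit_int (f z)) ->
  antiderivative f S -> last_passage S v z -> f z = 1.
Proof.
move=> hf hS [Sz last]; have := last (z + 1); rewrite hS Sz.
by case: (hf z) => -> //; lia.
Qed.

(** The drift [k] is positive, so [S <= v] holds somewhere but not arbitrarily far to the right; at
    the last such point [S] equals [v] because its steps are units. *)
Lemma last_passage_exists f S (N : nat) (k v : int) : (forall z, unit_int (f z)) ->
  antiderivative f S -> (0 < N)%N -> 0 < k -> (forall z, S (z + N%:Z) = S z + k) ->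
  exists z, last_passage S v z.
Proof.
move=> hf hS N0 k0 SN; have [z0 Sz0] : exists z0, S z0 <= v.
  exists (0 + - (absz (S 0 - v))%:Z * N%:Z); rewrite (shift_mul SN).
  have := ler_norm (S 0 - v); rewrite -abszE; move: (absz _) => j.
  have : 0 <= j%:Z * (k - 1) by apply: mulr_ge0; lia.
  by rewrite mulrBr mulr1 mulNr; move: (_ * k) (S 0); lia.
have lip (i : nat) z : S z - i%:Z <= S (z + i%:Z).
  elim: i => [|i IHi]; first by rewrite addr0 subr0.
  rewrite intS [1 + _]addrC [z + _]addrA hS.
  by move: (hf (z + i%:Z)) IHi; move: (f _) (S (z + _)) (S z) => ? ? ? [] ->; lia.
(* Each full period raises [S] by at least 1, and the fewer than [N] remaining steps lower it by
   less than [N]. *)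
have bound (i : nat) : S (z0 + i%:Z) <= v -> (i <= (`|v - S z0| + N) * N + N)%N.
  rewrite leqNgt; apply: contraTN => lt; rewrite -ltNge.
  rewrite {1}(divn_eq i N) PoszD PoszM addrCA addrC (shift_mul SN).
  have : (`|v - S z0| + N <= i %/ N)%N by rewrite leq_divRL //; lia.
  have : (i %/ N)%:Z <= (i %/ N)%:Z * k by rewrite ler_peMr //; lia.
  have := lip (i %% N)%N z0; have := ltn_pmod i N0.
  by move: (_ * k) (S (z0 + _)) (S z0) => ? ? ?; lia.
have ex0 : exists i : nat, S (z0 + i%:Z) <= v by exists 0%N; rewrite addr0.
case: (ex_maxnP ex0 bound) => i Si max.
have gt z : z0 + i%:Z < z -> v < S z.
  move=> lt; rewrite ltNge; apply/negP => le.
  have ez : z = z0 + `|z - z0|%:Z by lia.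
  by have := max `|z - z0|%N; rewrite -ez => /(_ le); lia.
exists (z0 + i%:Z); split=> //.
have := gt (z0 + i%:Z + 1); rewrite hS.
by case: (hf (z0 + i%:Z)) => ->; lia.
Qed.

Section Trap.
Variables (f S : int -> int) (a b : nat -> int) (c u A B : int).
Hypotheses (hf : forall z, unit_int (f z)) (hS : antiderivative f S).
Hypotheses (ab : stitch_orbit f f a b) (abc : forall t, level f S (a t) (b t) = 2 * c - 1).
Hypotheses (hA : last_passage S u A) (hB : last_passage S (u + c) B).

(* [c] is normalized so that the invariant is [2 * c - 1], which then gives the
   difference of the levels at [B] and [A]. *)
Lemma trap_stays t : A <= a t -> B <= b t -> A <= a t.+1 /\ B <= b t.+1.
Proof.
have fA := last_passage_step hf hS hA; have fB := last_passage_step hf hS hB.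
have [[SA lA] [SB lB]] := (hA, hB).
move=> At Bt; have [ea eb] := ab t.
have A' : A <= a t.+1.
  rewrite ea; case: (hf (b t)) => fb; rewrite fb; first by lia.
  have [lt|ne|/esym e] := ltgtP A (a t); [lia| lia|].
  (* Leaving leftwards from column [A] would require [S (b t) = u + c], although [b t] is beyond the
     last passage [B]. *)
  have := abc t; rewrite /level e fA fb SA => H.
  have Bb : B < b t by rewrite lt_neqAle Bt andbT; apply/eqP => Bb; move: fb; rewrite -Bb fB.
  by have := lB _ Bb; lia.
split=> //; rewrite eb; case: (hf (a t.+1)) => fa; rewrite fa; first by lia.
have [lt|ne|/esym e] := ltgtP B (b t); [lia| lia|].
(* Leaving downwards from row [B] would require [S] to be [u + 1] at [a t.+1], hence [u] one column
   further, beyond [A]. *)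
have := abc t; rewrite (level_horizontal _ hS) // -ea e fB fa SB => H.
have Aa : A < a t.+1 by rewrite lt_neqAle A' andbT; apply/eqP => Aa; move: fa; rewrite -Aa fA.
by have := lA (a t.+1 + 1); rewrite hS fa; lia.
Qed.

(** Entering through column [A] would need [S (b t) = u + c - 1] at or above [B], where [S] is at
    least [u + c]. Entering from below leads to row [B], where the invariant gives [S = u] at the
    current column, which must be [A]. *)
Lemma trap_entry t : A <= a t.+1 -> B <= b t.+1 -> ~ (A <= a t /\ B <= b t) ->
  a t.+1 = A /\ b t.+1 = B.
Proof.
have fA := last_passage_step hf hS hA; have fB := last_passage_step hf hS hB.
have [[SA lA] [SB lB]] := (hA, hB).
move=> At Bt nT; have [ea eb] := ab t.
have leB z : B <= z -> u + c <= S z.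
  by rewrite le_eqVlt => /orP[/eqP <-|/lB]; lia.
have [Bb|bB] := lerP B (b t).
  case: (hf (b t)) => fb; rewrite fb in ea; last by lia.
  have eA : a t.+1 = A by lia.
  have := abc t; rewrite (level_horizontal _ hS) // fb -ea eA fA SA.
  by have := leB _ Bb; lia.
have fa : f (a t.+1) = 1 by case: (hf (a t.+1)) => fa //; lia.
have eB : b t.+1 = B by lia.
split=> //; apply/eqP; rewrite eq_le At andbT leNgt; apply/negP => /lA.
by have := abc t.+1; rewrite /level eB SB fa fB; lia.
Qed.

End Trap.

Lemma last_passage_shift (S : int -> int) (p k m v z : int) :
    (forall z, S (z + p) = S z + k) -> last_passage S v z ->
  last_passage S (v + m * k) (z + m * p).
Proof.
move=> Sp [Sz last]; split; first by rewrite (shift_mul Sp) Sz.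
move=> z' lt; rewrite -(subrK (m * p) z') (shift_mul Sp) ltrD2r.
by apply: last; rewrite ltrBrDr.
Qed.

(** Over one period the invariant would change by [2 * (mu - lambda) * k]. *)
Lemma symmetric_drift (N : nat) f (S : int -> int) a b n (lambda mu k : int) :
    (0 < N)%N -> (forall z, unit_int (f z)) -> antiderivative f S ->
    (forall z, S (z + N%:Z) = S z + k) -> lifted_loop N N f f a b n lambda mu ->
  mu * k = lambda * k.
Proof.
move=> N0 hf hS SN [n0 ab per _].
have fN m z : f (z + m * N%:Z) = f z.
  by apply: (@addrI _ (S (z + m * N%:Z))); rewrite -hS addrAC !(shift_mul SN) hS; ring.
have := level_orbit n hf hS ab; have := per 0%N; rewrite add0n /level => -[-> ->].
rewrite !fN !(shift_mul SN) => e.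
by apply/eqP; rewrite -subr_eq0; apply/eqP; apply: (@mulfI _ 2) => //; rewrite mulr0; lia.
Qed.

Lemma symmetric_homology_pos (N : nat) f (S : int -> int) a b n (lambda mu k : int) :
    (0 < N)%N -> (forall z, unit_int (f z)) -> antiderivative f S ->
    (forall z, S (z + N%:Z) = S z + k) -> 0 < k ->
    lifted_loop N N f f a b n lambda mu -> (lambda, mu) != 0 ->
  lambda = 1 /\ mu = 1.
Proof.
move=> N0 hf hS SN k0 ll nt.
have mul := symmetric_drift N0 hf hS SN ll.
have eml : mu = lambda by apply: (mulIf (lt0r_neq0 k0)).
move: nt ll; rewrite eml xpair_eqE andbb => l0 [n0 ab per dis] {mu mul eml}.
suff l1 : lambda = 1 by [].
have [c abc] : exists c, forall t, level f S (a t) (b t) = 2 * c - 1.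
  have [c ec] := level_odd S (a 0%N) (b 0%N) hf.
  by exists c => t; rewrite (level_orbit t hf hS ab).
have [A0 hA0] := last_passage_exists 0 hf hS N0 k0 SN.
have [B0 hB0] := last_passage_exists c hf hS N0 k0 SN.
pose A (m : int) := A0 + m * N%:Z; pose B (m : int) := B0 + m * N%:Z.
have hA m : last_passage S (m * k) (A m).
  by rewrite -[m * k]add0r; apply: last_passage_shift.
have hB m : last_passage S (m * k + c) (B m).
  by rewrite addrC; apply: last_passage_shift.
have le_mulN (i : nat) : (i <= i * N)%N by rewrite leq_pmulr.
have per' (q : nat) : a (q * n)%N = a 0%N + q%:Z * (lambda * N%:Z) /\
    b (q * n)%N = b 0%N + q%:Z * (lambda * N%:Z).
  by have := secant_periodic_mul per q 0; rewrite add0n.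
have lpos : 0 < lambda.
  rewrite lt_neqAle eq_sym l0 leNgt; apply/negP => lneg.
  (* This translate of the quadrant contains the initial point, so a path drifting down and left
     would have to escape from it. *)
  pose m : int := - (`|A0 - a 0%N| + `|B0 - b 0%N|)%N%:Z.
  have stay t : A m <= a t /\ B m <= b t.
    elim: t => [|t [IHa IHb]].
      by have := le_mulN (`|A0 - a 0%N| + `|B0 - b 0%N|)%N; rewrite /A /B /m; lia.
    exact: trap_stays hf hS ab abc (hA m) (hB m) _ IHa IHb.
  pose q := `|A m - a 0%N|.+1; have [le _] := stay (q * n)%N.
  have : q%:Z <= q%:Z * (- lambda * N%:Z) by rewrite ler_peMr //; nia.
  move: le; have [-> _] := per' q; rewrite mulNr mulrN /q.
  lia.
(* The path starts outside this quadrant and drifts into it; its first point there is the corner. *)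
have visit m : a 0%N < A m -> exists t, a t = A m /\ b t = B m.
  move=> lt.
  have ex : exists t, (A m <= a t) && (B m <= b t).
    pose q := (`|A m - a 0%N| + `|B m - b 0%N|)%N; exists (q * n)%N.
    have : q%:Z <= q%:Z * (lambda * N%:Z) by rewrite ler_peMr //; nia.
    have [-> ->] := per' q; rewrite /q.
    lia.
  case: (ex_minnP ex) => -[|t] /andP[At Bt] min; first by lia.
  exists t.+1; apply: (trap_entry hf hS ab abc (hA m) (hB m)) => //.
  by case=> At' Bt'; have := min t; rewrite At' Bt' ltnn => /(_ isT).
pose m : int := `|A0 - a 0%N|%N.+1.
have lt1 : a 0%N < A m by have := le_mulN `|A0 - a 0%N|%N.+1; rewrite /A /m; lia.
have lt2 : a 0%N < A (m + 1) by move: lt1; rewrite /A; lia.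
have [t1 [a1 b1]] := visit _ lt1; have [t2 [a2 b2]] := visit _ lt2.
(* Two successive corners are one vertex of the torus, so they are [i] periods apart:
   [i * lambda = 1]. *)
have : t1 = t2 %[mod n].
  apply: dis; rewrite ?a1 ?a2 ?b1 ?b2 /A /B mulrDl mul1r opprD addrACA subrr add0r.
  - by rewrite addrAC subrr add0r dvdzz.
  - by rewrite addrAC subrr add0r dvdzz.
have eAm : A (m + 1) = A m + N%:Z by rewrite /A mulrDl mul1r addrA.
have [le|/ltnW le] := leqP t1 t2 => /eqP.
  rewrite eq_sym eqn_mod_dvd // => /dvdnP [i ei].
  have : A (m + 1) = A m + i%:Z * (lambda * N%:Z).
    by rewrite -a1 -a2 -(proj1 (secant_periodic_mul per i t1)) -ei subnKC.
  rewrite eAm mulrA => /addrI e.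
  have : i%:Z * lambda = 1 by apply: (@mulIf _ N%:Z); rewrite ?mul1r //; lia.
  by move/(congr1 absz)/eqP; rewrite abszM muln_eq1 => /andP[_ /eqP]; lia.
rewrite eqn_mod_dvd // => /dvdnP [i ei].
have : A m = A (m + 1) + i%:Z * (lambda * N%:Z).
  by rewrite -a1 -a2 -(proj1 (secant_periodic_mul per i t2)) -ei subnKC.
have : 0 <= i%:Z * (lambda * N%:Z) by rewrite !mulr_ge0 //; lia.
by rewrite eAm; lia.
Qed.

Lemma lifted_loop_opp (M N : nat) f g a b n (lambda mu : int) :
    lifted_loop M N f g a b n lambda mu ->
  lifted_loop M N (fun z => - f (- z)) (fun z => - g (- z))
    (fun t => - a t) (fun t => - b t) n (- lambda) (- mu).
Proof.
move=> [n0 ab per dis]; split=> //.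
- by move=> t; have [ea eb] := ab t; rewrite !opprK -!opprD -ea -eb.
- by move=> t; have [-> ->] := per t; rewrite !opprD !mulNr.
- by move=> s t; rewrite -!opprD !rpredN; apply: dis.
Qed.

(** The offset 1 appears because [f z] is the increment from [z] to [z + 1], an interval that
    reflection reverses. *)
Lemma antiderivative_opp (f S : int -> int) : antiderivative f S ->
  antiderivative (fun z => - f (- z)) (fun z => S (1 - z)).
Proof. by move=> hS z; rewrite opprD addrCA subrr addr0 [1 - z]addrC hS addrK. Qed.

Lemma unit_intN z : unit_int z -> unit_int (- z).
Proof. by move=> [->|->]; [right | left]. Qed.

Lemma symmetric_homology (N : nat) f (S : int -> int) a b n (lambda mu k : int) :
    (0 < N)%N -> (forall z, unit_int (f z)) -> antiderivative f S ->
    (forall z, S (z + N%:Z) = S z + k) -> k != 0 ->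
    lifted_loop N N f f a b n lambda mu -> (lambda, mu) != 0 ->
  lambda = Num.sg k /\ mu = Num.sg k.
Proof.
move=> N0 hf hS SN; have [k_lt0|k_gt0|->] := ltgtP k 0; last by [].
  move=> _ ll nt; rewrite ltr0_sg //.
  suff [el em] : - lambda = 1 /\ - mu = 1 by rewrite -[lambda]opprK -[mu]opprK el em.
  apply: (symmetric_homology_pos (k := - k) N0 _ (antiderivative_opp hS) _ _ (lifted_loop_opp ll)).
  - by move=> z; apply: unit_intN.
  - move=> z; rewrite -[1 - z](subrK N%:Z) SN addrK; congr S; ring.
  - by rewrite oppr_gt0.
  - by move: nt; rewrite !xpair_eqE !oppr_eq0.
by move=> _ ll nt; rewrite gtr0_sg //; apply: symmetric_homology_pos ll nt.
Qed.

(** * Symmetric patterns of excess zero *)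

Lemma periodic_argmin (S : int -> int) (N : nat) : (0 < N)%N ->
  (forall z, S (z + N%:Z) = S z) -> exists A, forall z, S A <= S z.
Proof.
move=> N0 SN; have SN' m z : S (z + m * N%:Z) = S z.
  by rewrite (@shift_mul S N%:Z 0) ?mulr0 ?addr0 // => ?; rewrite SN addr0.
case: (@Order.TotalTheory.arg_minP _ _ _ (Ordinal N0) xpredT (fun i : 'I_N => S i%:Z)) => // i _ min.
exists i%:Z => z; rewrite (divz_eq z N%:Z) addrC SN'.
have lt : (absz (z %% N)%Z < N)%N.
  by rewrite -ltz_nat abszE ger0_norm ?modz_ge0 ?ltz_pmod //; lia.
have := min (Ordinal lt) isT; rewrite /= gez0_abs //.
by rewrite modz_ge0 //; lia.
Qed.

Lemma unit_steps_between (u : nat -> int) n A :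
    unit_steps u -> u 0%N < A <= u n \/ u n < A <= u 0%N ->
  exists t, u t = A - 1 /\ u t.+1 = A \/ u t = A /\ u t.+1 = A - 1.
Proof.
move=> hu; elim: n => [|n IHn] bt; first by lia.
have [lt|le] := ltrP (u n) A; have [lt0|le0] := ltrP (u 0%N) A; try by apply: IHn; lia.
- by exists n; case: (hu n); lia.
- by exists n; case: (hu n); lia.
Qed.

Lemma exists_translate (N : nat) (A z : int) : (0 < N)%N ->
  exists m : int, z < A + m * N%:Z <= z + N%:Z.
Proof.
move=> N0; exists (- ((A - z - 1) %/ N)%Z).
have := divz_eq (A - z - 1) N; have : 0 <= ((A - z - 1) %% N)%Z by rewrite modz_ge0 //; lia.
have : ((A - z - 1) %% N)%Z < N by rewrite ltz_pmod.
by move: (_ %% _)%Z (_ %/ _)%Z => r q; rewrite mulNr; move: (q * _); lia.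
Qed.

Lemma symmetric_nodrift_horizontal (N : nat) f (S : int -> int) a b n (lambda : int) :
    (0 < N)%N -> (forall z, unit_int (f z)) -> antiderivative f S ->
    (forall z, S (z + N%:Z) = S z) -> stitch_orbit f f a b ->
    a n = a 0%N + lambda * N%:Z ->
  lambda = 0.
Proof.
move=> N0 hf hS SN ab an; apply/eqP/negPn/negP => l0.
have [ua _] := orbit_unit_steps hf hf ab.
have SN' m z : S (z + m * N%:Z) = S z.
  by rewrite (@shift_mul S N%:Z 0) ?mulr0 ?addr0 // => ?; rewrite SN addr0.
have [c abc] : exists c, forall t, level f S (a t) (b t) = 2 * c - 1.
  have [c ec] := level_odd S (a 0%N) (b 0%N) hf.
  by exists c => t; rewrite (level_orbit t hf hS ab).
(* A nonzero multiple of [N] is travelled horizontally, so some translate of the edge between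
   columns [A - 1] and [A] is crossed. *)
have cross A : exists m t, let A' := A + m * N%:Z in
    a t = A' - 1 /\ a t.+1 = A' \/ a t = A' /\ a t.+1 = A' - 1.
  have [lpos|lneg] := ltrP 0 lambda.
    have [m bt] := exists_translate A (a 0%N) N0; exists m.
    apply: (unit_steps_between (n := n) ua); left; rewrite an.
    have : N%:Z <= lambda * N%:Z by rewrite ler_peMl //; lia.
    by lia.
  have [m bt] := exists_translate A (a n) N0; exists m.
  apply: (unit_steps_between (n := n) ua); right; move: bt; rewrite an.
  have : N%:Z <= - lambda * N%:Z by rewrite ler_peMl //; lia.
  by lia.
(* Hence c >= 1 for A a minimum of S, and c <= 0 for A a maximum of S. *)
have values A : exists z z', S z = S A + c /\ S z' = S A + c - 1.
  have [m [t /= crA]] := cross A; rewrite -(SN' m A).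
  move: (A + _) crA => A' crA; have [ea _] := ab t; have := hS (b t).
  (* In either direction [f A'] cancels from the invariant, which then gives [S] at [b t] and at
     [b t + 1]. *)
  case: (hf (b t)) ea => fb; rewrite fb => ea Sb1.
    exists (b t + 1), (b t); have := abc t; rewrite (level_horizontal _ hS) // fb -ea.
    have -> : a t.+1 = A' by lia.
    by rewrite Sb1; lia.
  exists (b t), (b t + 1); have := abc t; rewrite /level fb.
  have -> : a t = A' by lia.
  by rewrite Sb1; lia.
have [A minA] := periodic_argmin N0 SN.
have [B maxB] : exists B, forall z, S z <= S B.
  have [B minB] := @periodic_argmin (fun z => - S z) N N0 (fun z => congr1 _ (SN z)).
  by exists B => z; rewrite -lerN2 minB.
have [_ [z [_ ez]]] := values A; have [z' [_ [ez' _]]] := values B.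
by have := minA z; have := maxB z'; rewrite ez ez'; lia.
Qed.

Lemma symmetric_nodrift (N : nat) f (S : int -> int) a b n (lambda mu : int) :
    (0 < N)%N -> (forall z, unit_int (f z)) -> antiderivative f S ->
    (forall z, S (z + N%:Z) = S z) -> lifted_loop N N f f a b n lambda mu ->
  (lambda, mu) = 0.
Proof.
move=> N0 hf hS SN [n0 ab per _]; have [an bn] := per 0%N.
rewrite (symmetric_nodrift_horizontal N0 hf hS SN ab an).
(* Starting with the vertical edge instead exchanges the roles of rows and columns. *)
have ba : stitch_orbit f f b (fun t => a t.+1).
  by move=> t; have [_ ->] := ab t; have [-> _] := ab t.+1; have [_ ->] := ab t.
by rewrite (symmetric_nodrift_horizontal N0 hf hS SN ba bn).
Qed.

Lemma symmetric_loop_length (N : nat) f (S : int -> int) a b n (lambda mu k : int) :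
    (0 < N)%N -> (forall z, unit_int (f z)) -> antiderivative f S ->
    (forall z, S (z + N%:Z) = S z + k) ->
    lifted_loop N N f f a b n lambda mu -> (lambda, mu) != 0 ->
  exists z, 2 * n%:Z = 2 * `|k| + 8 * z.
Proof.
move=> N0 hf hS SN ll nt.
have [k0|k0] := eqVneq k 0.
  move: nt; rewrite (symmetric_nodrift N0 hf hS _ ll) ?eqxx // => z.
  by rewrite SN k0 addr0.
have [el em] := symmetric_homology N0 hf hS SN k0 ll nt.
have [z] := lifted_loop_length N0 N0 hf hf hS SN ll.
(* With both coordinates equal to the sign of [k], the general formula differs from [2 * |k|] by
   four times [N - k], up to sign. *)
have [j ej] : exists j, N%:Z - k = 2 * j.
  have uS : unit_steps (S \o Posz).
    by move=> t; rewrite /= -addn1 PoszD hS addrC addKr.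
  have un : unit_steps Posz by move=> t; left; lia.
  have [j] := unit_steps_parity 0 N un uS; rewrite /= -[N in S N]add0r SN.
  by rewrite (addrC (S _)) addrK => ej; exists j; lia.
rewrite el em; have [kn|kp|] := ltgtP k 0; [| |by move/eqP; rewrite (negbTE k0)].
  by rewrite ltr0_sg // => -> /=; exists (z - j); lia.
by rewrite gtr0_sg // => -> /=; exists (z + j); lia.
Qed.

(** * Lifting loops to the plane *)

Definition torus_point (M N : nat) (a b : int) : vertex M N := (a%:~R, b%:~R).

Lemma torus_pointP (M N : nat) (v : vertex M N) : exists a b, v = torus_point M N a b.
Proof.
case: v => i j; exists (i : nat)%:Z, (j : nat)%:Z.
by rewrite /torus_point -!pmulrn !natr_Zp.
Qed.

Lemma Zp_int_dvd (n : nat) (d : int) : (1 < n)%N -> (n %| d)%Z -> (d%:~R : 'Z_n) = 0.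
Proof. by move=> n1 /dvdzP [l ->]; rewrite intrM -pmulrn pchar_Zp // mulr0. Qed.

Lemma horizontalNvertical (M N : nat) (e : vertex M N * vertex M N) :
  horizontal e -> vertical e = false.
Proof.
case: e => -[i j] [i' j']; rewrite /horizontal /vertical /rightward /leftward /upward /downward /=.
by rewrite !xpair_eqE => /orP[] /andP[/eqP -> /eqP ->];
  rewrite ![_ + 1 == _]eq_sym ?Zp_step1 ?andbF.
Qed.

Definition row_arc (M N : nat) (x : 'Z_N -> int) (a b : int) :=
  (torus_point M N a b, torus_point M N (a + x b%:~R) b).

Definition column_arc (M N : nat) (y : 'Z_M -> int) (a b : int) :=
  (torus_point M N a b, torus_point M N a (b + y a%:~R)).

Lemma pattern_row_arc (M N : nat) x y (e : vertex M N * vertex M N) a b :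
    pattern x y e -> horizontal e -> e.1 = torus_point M N a b ->
  e = row_arc M x a b.
Proof.
move=> pe he; have := horizontalNvertical he; rewrite /vertical => /negbT.
case: e pe he => v v' pe he nv /= ev; rewrite ev {v ev} in pe he nv *.
rewrite /row_arc /torus_point intrD.
move: pe; rewrite /pattern; move/norP: nv => [/negbTE -> /negbTE ->] /=.
rewrite !orbF /rightward /leftward /= => /orP[] /andP[/eqP] => [-> /eqP ->|ev /eqP ->].
  by [].
by case: v' ev he => i j [/= -> ->] _; rewrite mulrN1z addrK.
Qed.

Lemma pattern_column_arc (M N : nat) x y (e : vertex M N * vertex M N) a b :
    pattern x y e -> vertical e -> e.1 = torus_point M N a b ->
  e = column_arc N y a b.
Proof.
move=> pe he; have : ~~ horizontal e by apply/negP => /horizontalNvertical; rewrite he.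
case: e pe he => v v' pe he nv /= ev; rewrite ev {v ev} in pe he nv *.
rewrite /column_arc /torus_point intrD.
move: pe; rewrite /pattern; move/norP: nv => [/negbTE -> /negbTE ->] /=.
rewrite /upward /downward /= => /orP[] /andP[/eqP] => [-> /eqP ->|ev /eqP ->].
  by [].
by case: v' ev he => i j [/= -> ->] _; rewrite mulrN1z addrK.
Qed.

Lemma delta_x_rcons (M N : nat) c (e : vertex M N * vertex M N) :
  delta_x (rcons c e) = delta_x c + ((rightward e)%:Z - (leftward e)%:Z).
Proof. by rewrite /delta_x -cats1 !count_cat /= !addn0 !PoszD; ring. Qed.

Lemma delta_y_rcons (M N : nat) c (e : vertex M N * vertex M N) :
  delta_y (rcons c e) = delta_y c + ((upward e)%:Z - (downward e)%:Z).
Proof. by rewrite /delta_y -cats1 !count_cat /= !addn0 !PoszD; ring. Qed.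

Lemma Zp_step2F (n : nat) (i : 'Z_n) : (2 < n)%N -> (i == i + 1 + 1) = false.
Proof. by move=> n2; apply/negP => /eqP e; apply: (Zp_step2 n2 e erefl). Qed.

Lemma row_arc_steps (M N : nat) (x : 'Z_N -> int) a b (e := row_arc M x a b) :
    (2 < M)%N -> unit_int (x b%:~R) ->
  [/\ horizontal e, (rightward e)%:Z - (leftward e)%:Z = x b%:~R
    & (upward e)%:Z - (downward e)%:Z = 0].
Proof.
rewrite /e /horizontal /rightward /leftward /upward /downward /row_arc /torus_point /=.
move=> M3; rewrite !xpair_eqE !eqxx !andbT intrD => -[] ->.
  by rewrite eqxx !Zp_step2F // !Zp_step1 !andbF.
rewrite mulrN1z subrK eqxx orbT !Zp_step1 !andbF.
rewrite (_ : _ == _ = false) //; apply/negP => /eqP /(congr1 (+%R^~ 1)).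
by rewrite subrK => /eqP; rewrite Zp_step2F.
Qed.

Lemma column_arc_steps (M N : nat) (y : 'Z_M -> int) a b (e := column_arc N y a b) :
    (2 < N)%N -> unit_int (y a%:~R) ->
  [/\ vertical e, (upward e)%:Z - (downward e)%:Z = y a%:~R
    & (rightward e)%:Z - (leftward e)%:Z = 0].
Proof.
rewrite /e /vertical /rightward /leftward /upward /downward /column_arc /torus_point /=.
move=> M3; rewrite !xpair_eqE !eqxx intrD => -[] ->.
  by rewrite eqxx !Zp_step2F // !Zp_step1.
rewrite mulrN1z subrK eqxx orbT !Zp_step1.
rewrite (_ : _ == _ = false) //; apply/negP => /eqP /(congr1 (+%R^~ 1)).
by rewrite subrK => /eqP; rewrite Zp_step2F.
Qed.

Lemma stitch_orbit_from (f g : int -> int) (a0 b0 : int) :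
  exists a b, [/\ a 0%N = a0, b 0%N = b0 & stitch_orbit f g a b].
Proof.
pose step (p : int * int) := (p.1 + f p.2, p.2 + g (p.1 + f p.2)).
exists (fun t => (iter t step (a0, b0)).1), (fun t => (iter t step (a0, b0)).2).
by split=> // t; rewrite iterS.
Qed.

Lemma cycle_nth (T : Type) (e : rel T) (x0 : T) (c : seq T) (i : nat) :
  cycle e c -> (i < size c)%N ->
  e (nth x0 c i) (nth x0 (rcons c (head x0 c)) i.+1).
Proof.
case: c => // x p /(pathP x0) h lt.
have := h i; rewrite size_rcons => /(_ lt).
by rewrite -rcons_cons nth_rcons /= lt.
Qed.

Definition stitch_lift (M N : nat) (x : 'Z_N -> int) (y : 'Z_M -> int)
    (c : seq (vertex M N * vertex M N)) : Prop :=
  exists n a b lambda mu,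
    [/\ size c = (2 * n)%N,
        lifted_loop M N (fun z => x z%:~R) (fun z => y z%:~R) a b n lambda mu,
        delta_x c = lambda * M%:Z & delta_y c = mu * N%:Z].

Lemma loop_lift_horizontal (M N : nat) (x : 'Z_N -> int) (y : 'Z_M -> int) e0 p :
    (2 < M)%N -> (2 < N)%N -> sign_string x -> sign_string y ->
    hitomezashi_loop x y (e0 :: p) -> horizontal e0 ->
  stitch_lift x y (e0 :: p).
Proof.
set c := e0 :: p => M3 N3 hx hy [_ /allP pat uni cons alt] h0.
have [a0 [b0 ev]] := torus_pointP e0.1.
have [a [b [ea0 eb0 ab]]] :=
  stitch_orbit_from (fun z => x z%:~R) (fun z => y z%:~R) a0 b0.
(* The first arc is repeated at the end, so that index [size c] expresses closure. *)
pose d := nth e0 (rcons c e0).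
have dc i : (i < size c)%N -> d i = nth e0 c i by move=> lt; rewrite /d nth_rcons lt.
have patd i : (i <= size c)%N -> pattern x y (d i).
  rewrite leq_eqVlt => /orP[/eqP ->|lt]; last by rewrite dc // pat ?mem_nth.
  by rewrite /d nth_rcons ltnn eqxx pat ?mem_head.
have nxt i : (i < size c)%N -> (d i.+1).1 = (d i).2 /\
    (horizontal (d i) && vertical (d i.+1) || vertical (d i) && horizontal (d i.+1)).
  move=> lt; rewrite (dc i lt); split; last exact: (cycle_nth e0 alt lt).
  by have /eqP := cycle_nth e0 cons lt.
have odd_arc t : (t.*2.+1 <= size c)%N -> d t.*2 = row_arc M x (a t) (b t) ->
    d t.*2.+1 = column_arc N y (a t.+1) (b t).
  move=> lt et; have [e1 al] := nxt _ lt; have [ea _] := ab t.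
  apply: pattern_column_arc (patd _ lt) _ _; last by rewrite e1 et ea.
  have [ht _ _] := row_arc_steps (a t) M3 (hx (b t)%:~R).
  by move: al; rewrite et ht (horizontalNvertical ht) orbF.
have even_arc t : (t.*2 <= size c)%N -> d t.*2 = row_arc M x (a t) (b t).
  elim: t => [_|t IHt lt].
    by apply: (@pattern_row_arc _ _ x y) (patd _ (leq0n _)) _ _; rewrite /d //= ea0 eb0.
  have et : d t.*2.+1 = column_arc N y (a t.+1) (b t) by apply: odd_arc; [|apply: IHt]; lia.
  have lt' : (t.*2.+1 < size c)%N by lia.
  have [e1 al] := nxt _ lt'; have [_ eb] := ab t.
  apply: pattern_row_arc (patd _ lt) _ _; last by rewrite doubleS e1 et eb.
  have [vt _ _] := column_arc_steps (b t) N3 (hy (a t.+1)%:~R).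
  by move: al; rewrite et vt; case: (boolP (horizontal _)) => [/horizontalNvertical|]; rewrite ?vt.
have d_last : d (size c) = e0 by rewrite /d nth_rcons ltnn eqxx.
(* For an odd length, the repeated arc [e0] would be a column arc. *)
have [n en] : exists n, size c = n.*2.
  exists (size c)./2; rewrite -[LHS]odd_double_half; case: (boolP (odd _)) => // od.
  have [t es] : exists t, size c = t.*2.+1.
    by exists (size c)./2; rewrite -[LHS]odd_double_half od.
  have := odd_arc t; rewrite -es leqnn d_last => /(_ isT).
  rewrite even_arc; last by rewrite es.
  move=> /(_ erefl) e; have [vt _ _] := column_arc_steps (b t) N3 (hy (a t.+1)%:~R).
  by move: vt; rewrite -e (horizontalNvertical h0).
have n0 : (0 < n)%N by move: en; rewrite /c /=; lia.
have dvd_eq m (z z' : int) : (1 < m)%N -> (m %| z' - z)%Z -> z%:~R = z'%:~R :> 'Z_m.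
  by move=> m1 /(Zp_int_dvd m1) /eqP; rewrite intrB subr_eq0 => /eqP.
have eq_dvd m (z z' : int) : (1 < m)%N -> z%:~R = z'%:~R :> 'Z_m ->
    exists l : int, z' = z + l * m%:Z.
  move=> m1 zz'; have [|l el] := @Zp_int_eq0 m (z' - z) m1.
    by rewrite intrB zz' subrr.
  by exists l; rewrite -el addrC subrK.
have [en_a en_b] : (a 0%N)%:~R = (a n)%:~R :> 'Z_M /\ (b 0%N)%:~R = (b n)%:~R :> 'Z_N.
  have := even_arc n; rewrite -en leqnn => /(_ isT); rewrite d_last.
  have := even_arc 0%N (leq0n _); rewrite /d /= => -> [-> -> _ _].
  by [].
have [[lambda el] [mu em]] := (eq_dvd _ _ _ (ltnW M3) en_a, eq_dvd _ _ _ (ltnW N3) en_b).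
have ll : lifted_loop M N (fun z => x z%:~R) (fun z => y z%:~R) a b n lambda mu.
  apply: lifted_loopP => //.
  - by move=> z; rewrite intrD -pmulrn pchar_Zp ?addr0 // ltnW.
  - by move=> z; rewrite intrD -pmulrn pchar_Zp ?addr0 // ltnW.
  move=> s t st /(dvd_eq _ _ _ (ltnW M3)) eA /(dvd_eq _ _ _ (ltnW N3)) eB.
  (* Equal tails give equal horizontal arcs, contrary to [uniq c]. *)
  have : d s.*2 == d t.*2.
    by rewrite !even_arc /row_arc /torus_point ?intrD ?eA ?eB //; lia.
  have [ls lt] : (s.*2 < size c)%N /\ (t.*2 < size c)%N by rewrite en !ltn_double; lia.
  by rewrite !dc // nth_uniq // => /eqP; lia.
have deltas t : (t <= n)%N -> delta_x (take t.*2 c) = a t - a 0%N /\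
    delta_y (take t.*2 c) = b t - b 0%N.
  elim: t => [|t IHt] lt; first by rewrite take0 /delta_x /delta_y /= !subrr.
  have lt1 : (t.*2.+1 < size c)%N by lia.
  have lt0 := ltnW lt1; rewrite doubleS !(take_nth e0) // -!dc //.
  rewrite !delta_x_rcons !delta_y_rcons.
  have [-> ->] := IHt (ltnW lt); have [ea eb] := ab t.
  have et : d t.*2 = row_arc M x (a t) (b t) by apply: even_arc; lia.
  rewrite (odd_arc t lt0 et) et.
  have [_ -> ->] := row_arc_steps (a t) M3 (hx (b t)%:~R).
  have [_ -> ->] := column_arc_steps (b t) N3 (hy (a t.+1)%:~R).
  by rewrite eb ea /=; split; ring.
have [dx dy] := deltas n (leqnn n).
exists n, a, b, lambda, mu; split=> //; first by rewrite mul2n.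
- by rewrite -[c]take_size en dx el addrC addKr.
- by rewrite -[c]take_size en dy em addrC addKr.
Qed.

Lemma hitomezashi_loop_rot (M N : nat) (x : 'Z_N -> int) (y : 'Z_M -> int) k c :
  hitomezashi_loop x y c -> hitomezashi_loop x y (rot k c).
Proof.
case=> c0 pat uni cons alt; split; rewrite ?rot_cycle ?rot_uniq //.
- by rewrite -size_eq0 size_rot size_eq0.
- by rewrite (eq_all_r (mem_rot k c)).
Qed.

Lemma loop_lift (M N : nat) (x : 'Z_N -> int) (y : 'Z_M -> int) c :
    (2 < M)%N -> (2 < N)%N -> sign_string x -> sign_string y ->
    hitomezashi_loop x y c ->
  stitch_lift x y c.
Proof.
move=> M3 N3 hx hy hc.
have [k [e [p [ek he]]]] : exists k e p, rot k c = e :: p /\ horizontal e.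
  have [c0 /allP pat _ _ alt] := hc; case: c c0 pat alt {hc} => // e [|e' p] _ _ alt.
    (* A circuit with one arc would alternate with itself. *)
    move: alt; rewrite /= /alternate andbT [vertical _ && _]andbC orbb => /andP[h v].
    by have := horizontalNvertical h; rewrite v.
  have [h|nh] := boolP (horizontal e); first by exists 0%N, e, (e' :: p); rewrite rot0.
  exists 1%N, e', (rcons p e); split; first by rewrite rot1_cons.
  by move: alt; rewrite /= /alternate (negbTE nh) => /andP[/andP[]].
have := hitomezashi_loop_rot k hc; rewrite ek => /loop_lift_horizontal.
move=> /(_ M3 N3 hx hy he) [n [a [b [lambda [mu [sz ll dx dy]]]]]].
have /permP per : perm_eq c (e :: p) by rewrite -ek perm_sym perm_rot perm_refl.
exists n, a, b, lambda, mu; split=> //.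
- by rewrite -sz -ek size_rot.
- by rewrite -dx /delta_x !per.
- by rewrite -dy /delta_y !per.
Qed.

(** * Antiderivatives of sign strings *)

Lemma antiderivative_exists (f : int -> int) :
  exists S, antiderivative f S /\ forall n : nat, S n%:Z = \sum_(0 <= i < n) f i%:Z.
Proof.
pose S z := match z with
  | Posz n => \sum_(0 <= i < n) f i%:Z
  | Negz n => - \sum_(0 <= i < n.+1) f (- i.+1%:Z)
  end.
exists S; split=> // -[n|n].
  by rewrite -PoszD addn1 /= big_nat_recr.
rewrite [S (Negz n)]/S big_nat_recr //= opprD NegzE -addrA addNr addr0.
case: n => [|n]; first by rewrite addNr /= !big_geq ?oppr0.
by rewrite (_ : - n.+2%:Z + 1 = Negz n) // NegzE; lia.
Qed.

Lemma sum_excess (N : nat) (x : 'Z_N -> int) : (1 < N)%N -> sign_string x ->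
  \sum_(0 <= i < N) x i%:~R = excess x.
Proof.
move=> N1 hx; have -> : \sum_(0 <= i < N) x i%:~R = \sum_(i : 'Z_N) x i.
  rewrite -[X in \sum_(0 <= _ < X) _](Zp_cast N1) big_mkord; apply: eq_bigr => i _.
  by rewrite -pmulrn natr_Zp.
rewrite /excess -!sum1_card !(big_morph Posz PoszD (erefl 0%:Z)).
rewrite [X in _ = X - _]big_mkcond [X in _ = _ - X]big_mkcond -sumrB.
by apply: eq_bigr => i _; rewrite !inE; case: (hx i) => ->.
Qed.

Lemma sign_antiderivative (N : nat) (x : 'Z_N -> int) : (1 < N)%N -> sign_string x ->
  exists S, antiderivative (fun z => x z%:~R) S /\
    forall z, S (z + N%:Z) = S z + excess x.
Proof.
move=> N1 hx; have [S [hS Snat]] := antiderivative_exists (fun z => x z%:~R).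
exists S; split=> // z; have SN := Snat N; rewrite sum_excess // in SN.
have S0 : S 0 = 0 by rewrite (Snat 0%N) big_geq.
have stepS y : S (y + 1 + N%:Z) - S (y + 1) = S (y + N%:Z) - S y.
  rewrite addrAC !hS intrD -pmulrn pchar_Zp // addr0; ring.
suff : S (z + N%:Z) - S z = excess x by move=> <-; rewrite subrKC.
elim/int_ind: z => [|n IHn|n IHn]; first by rewrite add0r SN S0 subr0.
  by rewrite intS [1 + _]addrC stepS.
by rewrite -stepS (_ : - n.+1%:Z + 1 = - n%:Z) //; lia.
Qed.

Lemma homology_eq (M N : nat) (c : seq (vertex M N * vertex M N)) (l m : int) :
  (0 < M)%N -> (0 < N)%N -> delta_x c = l * M%:Z -> delta_y c = m * N%:Z ->
  homology c = (l%:~R, m%:~R).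
Proof.
by move=> M0 N0 dx dy; rewrite /homology dx dy !intrM !mulfK // pnatr_eq0 -lt0n.
Qed.

Lemma eqz_mod8 (m p z : int) : m = p + 8 * z -> (m = p %[mod 8])%Z.
Proof. by move=> ->; rewrite addrC mulrC modzMDl. Qed.

Theorem theorem1p6 (M N : nat) (M_ge3 : (3 <= M)%N) (N_ge3 : (3 <= N)%N) :
  [/\ (forall (x : 'Z_N -> int) (y : 'Z_M -> int),
         sign_string x -> sign_string y ->
       forall c : seq (vertex M N * vertex M N),
         hitomezashi_loop x y c -> trivial_loop c ->
         size c = 4 %[mod 8]),
      (forall x : 'Z_N -> int,
         sign_string x ->
       forall c : seq (vertex N N * vertex N N),
         hitomezashi_loop x x c -> ~ trivial_loop c ->
         size c = (2 * `|excess x|)%N %[mod 8])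
    & (forall (x : 'Z_N -> int) (y : 'Z_M -> int),
         sign_string x -> sign_string y ->
       forall c : seq (vertex M N * vertex M N),
         hitomezashi_loop x y c -> ~ trivial_loop c ->
       forall lambda mu : int,
         homology c = (lambda%:~R, mu%:~R) ->
         ((size c)%:Z =
            2 * (mu * N%:Z + lambda * M%:Z - mu * excess x) %[mod 8])%Z)].
Proof.
have [M0 N0] : (0 < M)%N /\ (0 < N)%N by split; apply: leq_trans (_ : 3 <= _)%N.
(* The width is left general because the symmetric case has width [N]. *)
have trivialE M' (c : seq (vertex M' N * vertex M' N)) (l m : int) :
    homology c = (l%:~R, m%:~R) -> trivial_loop c <-> (l, m) = 0.
  rewrite /trivial_loop => ->; split=> [[/eqP + /eqP]|[-> ->]] //.
  by rewrite !intr_eq0 => /eqP -> /eqP ->.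
have int_rat (l m l' m' : int) : (l%:~R, m%:~R) = (l'%:~R, m'%:~R) :> rat * rat ->
    l = l' /\ m = m'.
  by move=> [/intr_inj -> /intr_inj ->].
split.
- move=> x y hx hy c hc tc.
  have [n [a [b [l [m [sz ll dx dy]]]]]] := loop_lift M_ge3 N_ge3 hx hy hc.
  have [l0 m0] := proj1 (trivialE _ _ _ _ (homology_eq M0 N0 dx dy)) tc.
  have [S [hS SN]] := sign_antiderivative (ltnW N_ge3) hx.
  have [z] := lifted_loop_length M0 N0 (fun z => hx z%:~R) (fun z => hy z%:~R) hS SN ll.
  by rewrite l0 m0 /= => ez; lia.
- move=> x hx c hc ntc.
  have [n [a [b [l [m [sz ll dx dy]]]]]] := loop_lift N_ge3 N_ge3 hx hx hc.
  have [S [hS SN]] := sign_antiderivative (ltnW N_ge3) hx.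
  have nt : (l, m) != 0.
    by apply/eqP => lm0; apply: ntc; apply/(trivialE _ _ _ _ (homology_eq N0 N0 dx dy)).
  have [z ez] := symmetric_loop_length N0 (fun z => hx z%:~R) hS SN ll nt.
  by lia.
- move=> x y hx hy c hc ntc lambda mu hom.
  have [n [a [b [l [m [sz ll dx dy]]]]]] := loop_lift M_ge3 N_ge3 hx hy hc.
  have := homology_eq M0 N0 dx dy; rewrite hom => /int_rat [el em]; subst l m.
  have [S [hS SN]] := sign_antiderivative (ltnW N_ge3) hx.
  have [z] := lifted_loop_length M0 N0 (fun z => hx z%:~R) (fun z => hy z%:~R) hS SN ll.
  case: ifP => [/andP[/eqP l0 /eqP m0] _|_ ez].
    by case: ntc; apply/(trivialE _ _ _ _ hom); rewrite l0 m0.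
  by apply: (eqz_mod8 (z := z)); rewrite -ez sz PoszM.
Qed.
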